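(* If $n\ge 4$, then the convex hull $\operatorname{conv}(\psi_n)$ of the constructible region $\psi_n\subset\mathbb{R}^{2^n-1}$ is not a closed subset of $\mathbb{R}^{2^n-1}$.
   Context: Write $[n]=\{1,\dots,n\}$ and let $e_1,\dots,e_n$ be the standard basis of $\mathbb{R}^n$. A body in $\mathbb{R}^n$ is a compact subset $T\subset\mathbb{R}^n$. For non-empty $A\subset[n]$, $T_A$ denotes the orthogonal projection of $T$ onto $\mathrm{Span}(A)=\mathrm{span}\{e_i: i\in A\}$, and $|T_A|$ denotes its $|A|$-dimensional volume (Lebesgue measure in $\mathrm{Span}(A)$). Vectors in $\mathbb{R}^{2^n-1}$ have coordinates indexed by the non-empty subsets of $[n]$. A vector $x\in\mathbb{R}^{2^n-1}$ is constructible if there is a body $T\subset\mathbb{R}^n$ (necessarily with $|T_A|>0$ for all non-empty $A$) such that $x_A=\log|T_A|$ for every non-empty $A\subset[n]$. The constructible region is $\psi_n=\{x\in\mathbb{R}^{2^n-1}: x \text{ is constructible}\}$. *)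

(* Defs.v *)
From HB Require Import structures.
From mathcomp Require Import all_boot all_order all_algebra.
From mathcomp Require Import all_classical all_reals all_analysis.

Set Implicit Arguments.
Unset Strict Implicit.
Unset Printing Implicit Defensive.
Import Order.TTheory GRing.Theory Num.Theory.
Import numFieldNormedType.Exports.
Local Open Scope classical_set_scope.
Local Open Scope ring_scope.

(* The library's sigma-finite instance on a binary product is shadowed by the
   one for subprobability measures, so sigma-finite structures are built from
   the bare property. *)
Section sigma_finite_measure_of.
Context d (T : measurableType d) (R : realType) (mu : {measure set T -> \bar R}).
Hypothesis mu_sigma_finite : sigma_finite setT mu.

Let m : set T -> \bar R := mu.
HB.instance Definition _ := Measure.on m.
HB.instance Definition _ :=
  Measure_isSigmaFinite.Build _ _ _ m mu_sigma_finite.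

Lemma sigma_finite_measure_of :
  exists m' : {sigma_finite_measure set T -> \bar R}, m' = mu :> (set T -> \bar R).
Proof. by exists m. Qed.

End sigma_finite_measure_of.

Section lebesgue_tuple.
Context {R : realType}.
Local Notation mR := (measurableTypeR R).
Local Open Scope ereal_scope.

Definition tcons k (p : mR * k.-tuple mR) : k.+1.-tuple mR :=
  [tuple of p.1 :: p.2].

(* The k-dimensional Lebesgue measure on the product sigma-algebra of R^k, as
   the k-fold product of the Lebesgue measure on R. Outside of that
   sigma-algebra its values are meaningless. *)
Fixpoint lebesgue_tuple (k : nat) : set (k.-tuple mR) -> \bar R :=
  if k is k'.+1 return set (k.-tuple mR) -> \bar R
  then pushforward (lebesgue_measure \x @lebesgue_tuple k') (@tcons k')
  else \d_([tuple] : 0.-tuple mR).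

Lemma measurable_tcons k : measurable_fun [set: mR * k.-tuple mR] (@tcons k).
Proof. exact: measurable_cons. Qed.

Lemma measurable_tuncons k :
  measurable_fun [set: k.+1.-tuple mR]
    (fun t => (tnth t ord0, [tuple of behead t]) : mR * k.-tuple mR).
Proof.
apply/measurable_fun_pair; first exact: measurable_tnth.
exact: measurable_behead.
Qed.

Lemma tconsK k : cancel (@tcons k)
  (fun t => (tnth t ord0, [tuple of behead t]) : mR * k.-tuple mR).
Proof.
by move=> [x t]; congr (_, _); apply: val_inj.
Qed.

Lemma lebesgue_tuple_exists k :
  exists m : {sigma_finite_measure set (k.-tuple mR) -> \bar R},
    @lebesgue_tuple k = m.
Proof.
elim: k => [|k [m mE]] /=; first by exists (\d_([tuple] : 0.-tuple mR)).
rewrite mE.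
pose mp : {measure set (mR * k.-tuple mR)%type -> \bar R} :=
  lebesgue_measure \x m.
pose q : {measure set (k.+1.-tuple mR) -> \bar R} :=
  measure_function_pushforward__canonical__measure_function_Measure
    mp (@measurable_tcons k).
have sq : sigma_finite setT q.
  have /sigma_finiteP[F [TF ndF Foo]] := sigma_finiteT (@lebesgue_measure R).
  have /sigma_finiteP[G [TG ndG Goo]] := sigma_finiteT m.
  pose g := fun t : k.+1.-tuple mR =>
    (tnth t ord0, [tuple of behead t]) : (mR * k.-tuple mR)%type.
  exists (fun i => g @^-1` (F i `*` G i)).
    apply/seteqP; split => // t _.
    have [i _ Fi] : (\bigcup_i F i) (g t).1 by rewrite -TF.
    have [j _ Gj] : (\bigcup_i G i) (g t).2 by rewrite -TG.
    exists (maxn i j) => //; split.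
    - by move: Fi; exact/subsetPset/ndF/leq_maxl.
    - by move: Gj; exact/subsetPset/ndG/leq_maxr.
  move=> i; have [mF Fi] := Foo i; have [mG Gi] := Goo i; split.
    rewrite -[X in measurable X]setTI; apply: measurable_tuncons => //.
    exact: measurableX.
  rewrite /q /= /pushforward -comp_preimage.
  rewrite (_ : g \o _ = id); last by apply/funext => x; exact: tconsK.
  by rewrite preimage_id product_measure1E// lte_mul_pinfty// ge0_fin_numE.
have [m' m'E] := sigma_finite_measure_of sq.
by exists m'; rewrite m'E.
Qed.

Let lebesgue_tuple0 k : @lebesgue_tuple k set0 = 0.
Proof. by have [m ->] := lebesgue_tuple_exists k; exact: measure0. Qed.

Let lebesgue_tuple_ge0 k A : 0 <= @lebesgue_tuple k A.
Proof. by have [m ->] := lebesgue_tuple_exists k; exact: measure_ge0. Qed.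

Let lebesgue_tuple_sigma_additive k : semi_sigma_additive (@lebesgue_tuple k).
Proof.
by have [m ->] := lebesgue_tuple_exists k; exact: measure_semi_sigma_additive.
Qed.

HB.instance Definition _ k := isMeasure.Build _ _ _ (@lebesgue_tuple k)
  (lebesgue_tuple0 k) (@lebesgue_tuple_ge0 k)
  (@lebesgue_tuple_sigma_additive k).

Let lebesgue_tuple_sigma_finite k : sigma_finite setT (@lebesgue_tuple k).
Proof. by have [m ->] := lebesgue_tuple_exists k; exact: sigma_finiteT. Qed.

HB.instance Definition _ k := Measure_isSigmaFinite.Build _ _ _
  (@lebesgue_tuple k) (@lebesgue_tuple_sigma_finite k).

Lemma lebesgue_tuple_box k (B : 'I_k -> set mR) :
  (forall i, measurable (B i)) ->
  lebesgue_tuple [set t : k.-tuple mR | forall i, B i (tnth t i)] =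
  \prod_(i < k) lebesgue_measure (B i).
Proof.
elim: k B => [|k IH] B mB.
  rewrite big_ord0 /= diracE mem_set//; by case.
pose D := [set t : k.-tuple mR | forall i, B (lift ord0 i) (tnth t i)].
have mD : measurable D.
  rewrite (_ : D =
      \bigcap_(i in [set: 'I_k]) ((fun t => tnth t i) @^-1` B (lift ord0 i))).
    apply: fin_bigcap_measurable => [|i _]; first exact: finite_finset.
    by rewrite -[X in measurable X]setTI; apply: measurable_tnth.
  by apply/seteqP; split => t Dt i => [_|]; exact: Dt.
rewrite big_ord_recl -IH//= /pushforward.
rewrite -product_measure1E//; congr (_ _).
apply/seteqP; split => -[x t] /=.
- move=> xt; split; first exact: (xt ord0).
  by move=> i; have := xt (lift ord0 i); rewrite tnthS.
- move=> [Bx Dt] i; case: (unliftP ord0 i) => [j ->|->//].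
  by rewrite tnthS; exact: Dt.
Qed.

End lebesgue_tuple.

Definition convex_hull (R : realType) (M : lmodType R) (S : set M) : set M :=
  smallest (@convex_set R M) S.

(* Coordinates of R^(2^n - 1) are indexed by 'I_#|nonempty_subsets n|; the j-th
   one belongs to the subset enum_val j of [n], where [n] is 'I_n. *)
Definition nonempty_subsets (n : nat) : {set {set 'I_n}} :=
  [set A | A != finset.set0]%SET.

Lemma card_nonempty_subsets n : #|nonempty_subsets n| = (2 ^ n - 1)%N.
Proof.
have := cardsC [set finset.set0 : {set 'I_n}]%SET.
rewrite cards1 -cardsT -powersetT card_powerset cardsT card_ord => <-.
rewrite addKn; apply: eq_card => A; rewrite !inE //.
Qed.

Section constructible_region.
Context {R : realType} {n : nat}.

(* orthogonal projection onto span {e_i | i in A}: the sum of <v, e_i> e_i *)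
Definition orthoproj (A : {set 'I_n}) (v : 'rV[R]_n) : 'rV[R]_n :=
  \sum_(i in A) v ord0 i *: delta_mx ord0 i.

(* Isometry from span {e_i | i in A}, with its orthonormal basis (e_i), to
   R^#|A|; it transports Lebesgue measure. *)
Definition span_coord (A : {set 'I_n}) (v : 'rV[R]_n) :
    #|A|.-tuple (measurableTypeR R) :=
  [tuple v ord0 (enum_val i) | i < #|A|].

Definition proj_volume (A : {set 'I_n}) (T : set 'rV[R]_n) : \bar R :=
  lebesgue_tuple (span_coord A @` (orthoproj A @` T)).

(* As lne 0 = -oo and lne +oo = +oo, the equation forces every projection to
   have a positive finite volume. *)
Definition constructible (x : 'rV[R]_#|nonempty_subsets n|) : Prop :=
  exists T : set 'rV[R]_n, compact T /\
    forall j : 'I_#|nonempty_subsets n|,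
      (x ord0 j)%:E = lne (proj_volume (enum_val j) T).

End constructible_region.

Definition constructible_region (R : realType) (n : nat) :
    set 'rV[R]_#|nonempty_subsets n| :=
  [set x | constructible x].
Arguments constructible_region : clear implicits.

(* Main.v *)
(* If equality holds in the Loomis-Whitney inequality
   |T_123|^2 <= |T_12| |T_13| |T_23| then almost every nonempty slice of T_12 in
   direction 1 has the same length |T_23| |T_12| / |T_123|.  Hence if equality
   also holds for {1, 2, 4}, the shared shadow T_12 forces
   |T_23| / |T_123| = |T_24| / |T_124|.  In logarithmic coordinates the two
   equalities cut out a face of the convex hull on which one more linear
   equation holds.  The limit point violating that equation is
   x_A = max (sum_A b1, sum_A b2) with b1 = (1, -1, 0, -2, 0, ...) and
   b2 = (-1, 1, -2, 0, 0, ...): it is approached by (1/N) log |T_A|, where T is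
   the union of the two boxes with side lengths exp (N b1) and exp (N b2). *)
Require Import Defs.
From mathcomp Require Import all_boot all_order all_algebra.
From mathcomp Require Import all_classical all_reals all_analysis.
From mathcomp Require Import measurable_realfun ring lra.
Import Order.TTheory GRing.Theory Num.Theory.
Import numFieldNormedType.Exports.

Set Implicit Arguments.
Unset Strict Implicit.
Unset Printing Implicit Defensive.

Local Open Scope classical_set_scope.
Local Open Scope ring_scope.

(** * Equality almost everywhere from equality of integrals *)

Section integral_lemmas.
Context d (T : measurableType d) (R : realType).
Variable mu : {measure set T -> \bar R}.
Local Open Scope ereal_scope.

(** The integrals of [f] and [g] are ordered both on [E] and on its complement, while their totals
    are equal and finite. Hence they agree on every measurable [E], which gives equality almost
    everywhere. *)
Lemma ge0_le_integral_ae_eq (f g : T -> \bar R) :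
  measurable_fun setT f -> measurable_fun setT g ->
  (forall x, 0 <= f x) -> (forall x, f x <= g x) ->
  \int[mu]_x f x = \int[mu]_x g x -> \int[mu]_x f x < +oo ->
  {ae mu, forall x, f x = g x}.
Proof.
move=> mf mg f0 fg fgE foo.
have g0 x : 0 <= g x by exact: le_trans (fg x).
have fi : mu.-integrable setT f.
  apply/integrableP; split=> //.
  by under eq_integral do rewrite gee0_abs//.
suff : ae_eq mu setT f g by apply: filterS => x; apply.
apply: integral_ae_eq => // E _ mE.
have mCE := measurableC mE.
have split_int h : measurable_fun setT h -> (forall x, 0 <= h x) ->
    \int[mu]_x h x = \int[mu]_(x in E) h x + \int[mu]_(x in ~` E) h x.
  move=> mh h0; rewrite -ge0_integral_setU ?setUv//.
  by apply/disj_setPCl.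
have le_int A : measurable A -> \int[mu]_(x in A) f x <= \int[mu]_(x in A) g x.
  move=> mA; apply: ge0_le_integral => //; exact: measurable_funTS.
have fin A : measurable A -> \int[mu]_(x in A) f x \is a fin_num.
  move=> mA; rewrite ge0_fin_numE ?integral_ge0//.
  apply: le_lt_trans foo; exact: ge0_subset_integral.
have goo : \int[mu]_x g x < +oo by rewrite -fgE.
have fing A : measurable A -> \int[mu]_(x in A) g x \is a fin_num.
  move=> mA; rewrite ge0_fin_numE ?integral_ge0//.
  apply: le_lt_trans goo; exact: ge0_subset_integral.
have := le_int _ mCE; have := le_int _ mE; have := fgE.
rewrite !split_int//.
move: (fin _ mE) (fin _ mCE) (fing _ mE) (fing _ mCE).
move=> /fineK <- /fineK <- /fineK <- /fineK <-.
rewrite -!EFinD !lee_fin => -[] h1 h2 h3; congr (_%:E); lra.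
Qed.

End integral_lemmas.

(** * Slicing along the first coordinate and Fubini *)

Section slices.
Context {R : realType}.
Local Notation mR := (measurableTypeR R).
Local Open Scope ereal_scope.

Definition slice k (E : set (k.+1.-tuple mR)) (x : mR) : set (k.-tuple mR) :=
  [set t | E (tcons (x, t))].

Let sliceE k (E : set (k.+1.-tuple mR)) x :
  slice E x = xsection (@tcons R k @^-1` E) x.
Proof. by rewrite xsectionE. Qed.

Let measurable_preimage_tcons k (E : set (k.+1.-tuple mR)) :
  measurable E -> measurable (@tcons R k @^-1` E).
Proof. by move=> mE; rewrite -[X in measurable X]setTI; exact: measurable_tcons. Qed.

Lemma measurable_slice k (E : set (k.+1.-tuple mR)) x :
  measurable E -> measurable (slice E x).
Proof.
by move=> mE; rewrite sliceE; apply: measurable_xsection; exact: measurable_preimage_tcons.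
Qed.

Lemma measurable_fun_slice k (E : set (k.+1.-tuple mR)) :
  measurable E ->
  measurable_fun [set: mR] (fun x => lebesgue_tuple (slice E x)).
Proof.
move=> /measurable_preimage_tcons mE.
under eq_fun do rewrite sliceE.
exact: measurable_fun_xsection.
Qed.

Lemma lebesgue_tupleS k (E : set (k.+1.-tuple mR)) :
  lebesgue_tuple E = \int[lebesgue_measure]_x lebesgue_tuple (slice E x).
Proof.
rewrite /= /pushforward /product_measure1.
by apply: eq_integral => x _; rewrite sliceE.
Qed.

(** Slicing a planar set twice leaves a subset of the one-point space, whose Dirac measure is the
    indicator of the planar set. *)
Lemma lebesgue_tuple0_01 (E : set (0.-tuple mR)) :
  lebesgue_tuple E = 0 /\ ~ E [tuple] \/ lebesgue_tuple E = 1 /\ E [tuple].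
Proof.
rewrite /= diracE; case: (boolP (_ \in _)) => /=; rewrite ?inE ?notin_setE; tauto.
Qed.

End slices.

(** * The pointwise inequality and its equality case *)

Section pointwise.
Context {R : realType}.
Implicit Types (k : R) (m q s : \bar R).
Local Open Scope ereal_scope.

(* [2 k m <= k ^ 2 + m ^ 2 <= k ^ 2 + q s], where [k] stands for the average
   height of the body over its planar shadow. *)
Lemma double_le_sqr_add_mul k m q s : (0 < k)%R -> 0 <= m -> m <= q -> m <= s ->
  (2 * k)%:E * m <= (k ^+ 2)%:E + q * s.
Proof.
move=> k0 m0 mq ms.
apply: (@le_trans _ _ ((k ^+ 2)%:E + m * m)); last first.
  by rewrite leeD2l// lee_pmul.
case: m m0 {mq ms} => [m| |]//= m0.
- by rewrite -!EFinM -EFinD lee_fin; have := sqr_ge0 (k - m); nra.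
- by rewrite mulyy addey// leey.
Qed.

(** As [q * s >= m ^ 2], equality forces [(k - m) ^ 2 <= 0], so [m = k] and [q * s = k ^ 2]. Both
    factors are at least [k], so both equal [k]. Finite [q] makes [m] finite, and positive [q] then
    rules out [s = +oo]. *)
Lemma double_eq_sqr_add_mul k m q s :
  (0 < k)%R -> 0 <= m -> m <= q -> m <= s -> 0 < q -> q < +oo ->
  (2 * k)%:E * m = (k ^+ 2)%:E + q * s -> s = k%:E.
Proof.
move=> k0 m0 mq ms.
case: q mq => [q| |]//= mq q0 _.
have mE : m \is a fin_num by rewrite ge0_fin_numE// (le_lt_trans mq) ?ltry.
move: mE m0 mq ms => /fineK <-; set r := fine m.
rewrite lee_fin lee_fin lte_fin in q0 * => r0 rq.
case: s => [s| |]//; last by rewrite gt0_muley.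
rewrite lee_fin -!EFinM -EFinD => rs [] eq.
have rk : r = k.
  apply/eqP; rewrite -subr_eq0 -sqrf_eq0 eq_le sqr_ge0 andbT.
  have : (r * r <= q * s)%R by exact: ler_pM.
  nra.
have ? : (q = k)%R by nra.
congr (_%:E); nra.
Qed.

End pointwise.

(** * The Loomis-Whitney inequality in dimension three and its equality case *)

Section loomis_whitney.
Context {R : realType}.
Local Notation mR := (measurableTypeR R).
Local Notation vol := lebesgue_tuple.
Local Notation lambda := (@lebesgue_measure R).
Local Open Scope ereal_scope.

Variables (V : set (3.-tuple mR)) (P Q S : set (2.-tuple mR)).
Hypotheses (mV : measurable V) (mP : measurable P).
Hypotheses (mQ : measurable Q) (mS : measurable S).
Hypothesis VPQS : forall x y (t : 1.-tuple mR), V (tcons (x, tcons (y, t))) ->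
  [/\ P (tcons (x, tcons (y, [tuple]))), Q (tcons (x, t)) & S (tcons (y, t))].
Variables v p q s : R.
Hypotheses (v0 : (0 < v)%R) (p0 : (0 < p)%R) (s0 : (0 < s)%R).
Hypotheses (volV : vol V = v%:E) (volP : vol P = p%:E).
Hypotheses (volQ : vol Q = q%:E) (volS : vol S = s%:E).

Let vol_ge0 k (E : set (k.-tuple mR)) : 0 <= vol E.
Proof. exact: measure_ge0. Qed.

(** [m x y] is the length of the fibre of [V] above [(x, y)], and [e] is the indicator of [P]. *)
Let m x y := vol (slice (slice V x) y).
Let e x y := vol (slice (slice P x) y).

Let m_le_q x y : m x y <= vol (slice Q x).
Proof.
rewrite le_measure ?inE//; do ?exact: measurable_slice.
  by do 2 apply: measurable_slice.
by move=> t /VPQS[].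
Qed.

Let m_le_s x y : m x y <= vol (slice S y).
Proof.
rewrite le_measure ?inE//; do ?exact: measurable_slice.
  by do 2 apply: measurable_slice.
by move=> t /VPQS[].
Qed.

Let e01 x y : e x y = 0 /\ m x y = 0 \/ e x y = 1.
Proof.
rewrite /e /m; have [[-> nP]|[-> _]] := lebesgue_tuple0_01 (slice (slice P x) y).
  left; split => //; rewrite (_ : slice _ _ = set0) ?measure0//.
  by apply/seteqP; split => // t /VPQS[].
by right.
Qed.

(** [w] and [z] are the two sides of the pointwise inequality, with [k ^ 2] cut off outside [P],
    where [m] vanishes. [wint] and [zint] are their integrals over [y]. *)
Let wint k x := (2 * k)%:E * vol (slice V x).
Let zint k x := (k ^+ 2)%:E * vol (slice P x) + vol (slice Q x) * vol S.
Let w k x y := (2 * k)%:E * m x y.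
Let z k x y := (k ^+ 2)%:E * e x y + vol (slice Q x) * vol (slice S y).

Let w_le_z k x y : (0 < k)%R -> w k x y <= z k x y.
Proof.
move=> k0; rewrite /w /z; case: (e01 x y) => [[-> ->]|->].
  by rewrite !mule0 add0e mule_ge0.
by rewrite mule1; apply: double_le_sqr_add_mul; rewrite ?measure_ge0.
Qed.

Let mslice k (E : set (k.+1.-tuple mR)) : measurable E ->
  measurable_fun [set: mR] (fun x => vol (slice E x)).
Proof. exact: measurable_fun_slice. Qed.

Let m_w k x : measurable_fun [set: mR] (w k x).
Proof.
by apply: measurable_funeM; apply: mslice; apply: measurable_slice.
Qed.

Let m_z k x : measurable_fun [set: mR] (z k x).
Proof.
apply: emeasurable_funD; apply: measurable_funeM; apply: mslice => //.
exact: measurable_slice.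
Qed.

Let m_wint k : measurable_fun [set: mR] (wint k).
Proof. by apply: measurable_funeM; apply: mslice. Qed.

Let m_zint k : measurable_fun [set: mR] (zint k).
Proof.
apply: emeasurable_funD; first by apply: measurable_funeM; apply: mslice.
by under eq_fun do rewrite muleC; apply: measurable_funeM; apply: mslice.
Qed.

Let w_ge0 k x y : (0 < k)%R -> 0 <= w k x y.
Proof. by move=> k0; rewrite mule_ge0// lee_fin mulr_ge0// ltW. Qed.

Let intZ j (E : set (j.+1.-tuple mR)) c : measurable E -> 0 <= c ->
  \int[lambda]_x (c * vol (slice E x)) = c * vol E.
Proof.
move=> mE c0; rewrite (ge0_integralZl _ measurableT _ _ c0).
- by rewrite -(lebesgue_tupleS E).
- exact: mslice.
- by move=> x _; exact: measure_ge0.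
Qed.

Let int_w k x : (0 < k)%R -> \int[lambda]_y w k x y = wint k x.
Proof.
move=> k0; apply: intZ; first exact: measurable_slice.
by rewrite lee_fin mulr_ge0// ltW.
Qed.

Let int_z k x : \int[lambda]_y z k x y = zint k x.
Proof.
rewrite /z /zint (ge0_integralD _ measurableT).
- congr (_ + _); apply: intZ => //; first exact: measurable_slice.
  by rewrite lee_fin sqr_ge0.
- by move=> y _; rewrite mule_ge0// lee_fin sqr_ge0.
- by apply: measurable_funeM; apply: mslice; exact: measurable_slice.
- by move=> y _; rewrite mule_ge0.
- by apply: measurable_funeM; exact: mslice.
Qed.

Let w_le_zint k x : (0 < k)%R -> wint k x <= zint k x.
Proof.
move=> k0; rewrite -int_w// -int_z; apply: ge0_le_integral => //.
- by move=> y _; exact: w_ge0.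
- by move=> y _; exact: w_le_z.
Qed.

Let wint_ge0 k x : (0 < k)%R -> 0 <= wint k x.
Proof. by move=> k0; rewrite -int_w// integral_ge0// => y _; exact: w_ge0. Qed.

Let int_wint k : (0 < k)%R -> \int[lambda]_x wint k x = (2 * k * v)%:E.
Proof.
by move=> k0; rewrite /wint intZ ?volV// lee_fin mulr_ge0// ltW.
Qed.

Let int_zint k : \int[lambda]_x zint k x = (k ^+ 2 * p + q * s)%:E.
Proof.
rewrite /zint (ge0_integralD _ measurableT).
- rewrite intZ ?volP ?lee_fin ?sqr_ge0//.
  under eq_integral do rewrite muleC.
  by rewrite intZ ?volQ ?volS ?lee_fin ?(ltW s0)// EFinD !EFinM (muleC q%:E).
- by move=> y _; rewrite mule_ge0// lee_fin sqr_ge0.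
- by apply: measurable_funeM; exact: mslice.
- by move=> y _; rewrite mule_ge0.
- by under eq_fun do rewrite muleC; apply: measurable_funeM; apply: mslice.
Qed.

(** Integrating over [x] gives [2 * k * v <= k ^ 2 * p + q * s] for every positive [k]; [k = v / p]
    is the optimal choice. *)
Lemma loomis_whitney : (v ^+ 2 <= p * q * s)%R.
Proof.
pose k := (v / p)%R; have k0 : (0 < k)%R by rewrite divr_gt0.
have : (2 * k * v)%:E <= (k ^+ 2 * p + q * s)%:E.
  rewrite -int_wint// -int_zint; apply: ge0_le_integral => //.
  - by move=> y _; exact: wint_ge0.
  - by move=> y _; exact: w_le_zint.
have pk : v = (k * p)%R by rewrite /k divfK// gt_eqF.
rewrite lee_fin pk => h; have {}h : (k ^+ 2 * p <= q * s)%R by nra.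
have -> : ((k * p) ^+ 2 = p * (k ^+ 2 * p))%R by ring.
by rewrite -(mulrA p q s) ler_pM2l.
Qed.

(** With [k = v / p] the integrals of [wint] and [zint] coincide, so for almost every [x] the
    functions [w k x] and [z k x] have equal integrals and agree almost everywhere, unless the slice
    of [Q] is null. The pointwise equality case then relates [S] to the slice of [P]. *)
Lemma loomis_whitney_eq : (v ^+ 2 = p * q * s)%R ->
  {ae lambda, forall x, vol (slice P x) = 0 \/ vol (slice P x) = (s * p / v)%:E}.
Proof.
move=> eqv; pose k := (v / p)%R; have k0 : (0 < k)%R by rewrite divr_gt0.
have pk : v = (k * p)%R by rewrite /k divfK// gt_eqF.
have eqi : (2 * k * v = k ^+ 2 * p + q * s)%R.
  apply: (mulfI (lt0r_neq0 p0)); rewrite mulrDr [(p * (q * s))%R]mulrA -eqv pk.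
  ring.
have wz : {ae lambda, forall x, wint k x = zint k x}.
  apply: ge0_le_integral_ae_eq => //.
  - by move=> x; exact: wint_ge0.
  - by move=> x; exact: w_le_zint.
  - by rewrite int_wint// int_zint eqi.
  - by rewrite int_wint// ltry.
have wfin : {ae lambda, forall x, wint k x < +oo}.
  have : lambda.-integrable setT (wint k).
    apply/integrableP; split => //.
    under eq_integral do rewrite gee0_abs ?wint_ge0//.
    by rewrite int_wint// ltry.
  move=> /integrable_ae -/(_ measurableT); apply: filterS => x /(_ I).
  by rewrite ge0_fin_numE// wint_ge0.
apply: filterS2 wz wfin => x wzx wx.
have zx : zint k x < +oo by rewrite -wzx.
have := vol_ge0 (slice Q x); rewrite le_eqVlt => /predU1P[qx0|qx0].
  (* If the slice of [Q] is null, so are the fibres of [V] over it, and [zint k x = 0] leaves a null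
     slice of [P]. *)
  left; have /eqP : wint k x = 0.
    rewrite -int_w//; apply: integral0_eq => y _; rewrite /w.
    suff -> : m x y = 0 by rewrite mule0.
    by apply/eqP; rewrite eq_le vol_ge0 andbT (le_trans (m_le_q x y))// -qx0.
  rewrite wzx /zint -qx0 mul0e adde0 mule_eq0 => /orP[|/eqP//].
  by rewrite eqe sqrf_eq0 gt_eqF.
right.
(* Since [s > 0], an infinite slice of [Q] would make [zint k x] infinite. *)
have qxy : vol (slice Q x) < +oo.
  rewrite ltey; apply/eqP => qxoo; move: zx; rewrite /zint qxoo volS.
  rewrite gt0_mulye ?lte_fin// addey// -ltNye (@lt_le_trans _ _ 0)//.
  by rewrite mule_ge0// lee_fin sqr_ge0.
have aey : {ae lambda, forall y, w k x y = z k x y}.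
  apply: ge0_le_integral_ae_eq => //.
  - by move=> y; exact: w_ge0.
  - by move=> y; exact: w_le_z.
  - by rewrite int_w// int_z.
  - by rewrite int_w.
(* The fibre of [S] above almost every [y] has length [k] over the slice of [P] and [0] elsewhere.
   Integrating over [y] gives [s = k * vol (slice P x)]. *)
have sE : {ae lambda, forall y, vol (slice S y) = k%:E * e x y}.
  apply: filterS aey => y; rewrite /w /z; case: (e01 x y) => [[-> ->]|->].
    rewrite !mule0 add0e => /esym/eqP; rewrite mule_eq0 => /orP[|/eqP//].
    by rewrite gt_eqF.
  rewrite !mule1 => wz; apply: (@double_eq_sqr_add_mul _ k (m x y) (vol (slice Q x))) => //.
have : vol S = k%:E * vol (slice P x).
  rewrite (lebesgue_tupleS S) (@ge0_ae_eq_integral _ _ _ _ _ _ (fun y => k%:E * e x y))//.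
  - rewrite /w ge0_integralZl//; last by rewrite lee_fin ltW.
    + by rewrite -lebesgue_tupleS.
    + by apply: mslice; exact: measurable_slice.
  - exact: mslice.
  - by apply: measurable_funeM; apply: mslice; exact: measurable_slice.
  - by move=> y _; rewrite mule_ge0// lee_fin ltW.
  - by apply: filterS sE => y ->.
rewrite volS; case: (vol _) (vol_ge0 (slice P x)) => [r| |]//.
  move=> r0 [->]; congr (_%:E); rewrite pk; field.
  by rewrite !gt_eqF.
by rewrite gt0_muley.
Qed.

End loomis_whitney.

(** * Measurability of shadows and explicit coordinates for them *)

Section coordinate_projections.
Context {R : realType}.
Local Notation mR := (measurableTypeR R).

Definition coord_tuple n k (e : k.-tuple 'I_n) (v : 'rV[R]_n) : k.-tuple mR :=
  map_tuple (fun i => v ord0 i : mR) e.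

Definition rational_box k (a : k.-tuple rat) (j : nat) : set (k.-tuple mR) :=
  [set t | forall i, ball (ratr (tnth a i) : R) j.+1%:R^-1 (tnth t i)].

Lemma measurable_tuple_box k (B : 'I_k -> set mR) :
  (forall i, measurable (B i)) ->
  measurable [set t : k.-tuple mR | forall i, B i (tnth t i)].
Proof.
move=> mB; rewrite (_ : mkset _ =
    \bigcap_(i in [set: 'I_k]) ((fun t => tnth t i) @^-1` B i)).
  apply: fin_bigcap_measurable => [|i _]; first exact: finite_finset.
  by rewrite -[X in measurable X]setTI; apply: measurable_tnth.
by apply/seteqP; split => t Dt i => [_|]; exact: Dt.
Qed.

(** Tuples carry the product sigma-algebra, so the complement of [C] is written as the countable
    union of the rational boxes that it contains. *)
Lemma measurable_closed_coords k (C : set 'rV[R]_k) : closed C ->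
  measurable [set t : k.-tuple mR | C (\row_i tnth t i)].
Proof.
move=> clC; rewrite -[X in measurable X]setCK; apply: measurableC.
set K := [set t | _].
pose F (aj : k.-tuple rat * nat) : set (k.-tuple mR) :=
  if `[< rational_box aj.1 aj.2 `<=` ~` K >] then rational_box aj.1 aj.2 else set0.
suff -> : ~` K = \bigcup_aj F aj.
  apply: countable_bigcupT_measurable => // -[a j]; rewrite /F.
  case: asboolP => // _; 
  apply: (@measurable_tuple_box _ (fun i => ball (ratr (tnth a i) : R) _)) => i.
  exact: measurable_ball.
apply/seteqP; split => [t Kt|t [[a j] _]]; last first.
  by rewrite /F; case: asboolP => // + Ft; exact.
have /nbhs_ballP[r /= r0 Br] := open_nbhs_nbhs (conj (closed_openC clC) Kt).
(* Two radii must fit into [r]: one from [t] to the rational centre, one from the centre to any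
   other point of the box. *)
have [j jr] : exists j : nat, j.+1%:R^-1 + j.+1%:R^-1 < r :> R.
  have r2 : 0 < r / 2 by rewrite divr_gt0.
  have [N _ /(_ N (leqnn _))/=] := near_infty_natSinv_lt (PosNum r2).
  by exists N; rewrite (splitr r) ltrD.
have d0 : 0 < j.+1%:R^-1 :> R by rewrite invr_gt0.
have aP i : exists q : rat, ball (ratr q : R) j.+1%:R^-1 (tnth t i).
  have dense (x e : R) : 0 < e -> exists q : rat, `|ratr q - x| < e.
    move=> e0; have xe : x - e < x + e by rewrite ltrD2l gt0_cp.
    have [q] := rat_in_itvoo xe.
    by rewrite in_itv/= => /andP[q1 q2]; exists q; rewrite ltr_norml; lra.
  exact: dense.
pose a := [tuple sval (cid (aP i)) | i < k].
have at_ : rational_box a j t.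
  by move=> i; rewrite tnth_mktuple; exact: svalP (cid (aP i)).
exists (a, j) => //; rewrite /F; case: asboolP => //=; case.
move=> u au; apply: Br; split => // i0 i; rewrite !mxE.
apply: le_ball (ltW jr) _ _; apply: ball_triangle (au i).
exact/ball_sym/at_.
Qed.

(** A continuous image of a compact set is compact, hence closed; this makes the value of
    [lebesgue_tuple] on a shadow meaningful. *)
Lemma measurable_coord_tuple n k (e : k.-tuple 'I_n) (T : set 'rV[R]_n) :
  compact T -> measurable (coord_tuple e @` T).
Proof.
move=> cT; pose f (v : 'rV[R]_n) : 'rV[R]_k := \row_i v ord0 (tnth e i).
have cf : continuous f.
  move=> v A /= /nbhs_ballP[r /= r0 rA]; apply/nbhs_ballP; exists r => //=.
  by move=> w [_ vw]; apply: rA; split => // i j; rewrite !mxE.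
have clf : closed (f @` T).
  apply: compact_closed; first exact: norm_hausdorff.
  by apply: continuous_compact => //; exact: continuous_subspaceT.
rewrite (_ : _ @` _ = [set t | (f @` T) (\row_i tnth t i)]).
  exact: measurable_closed_coords.
apply/seteqP; split => [_ [v Tv <-]|t [v Tv ft]] /=.
  by exists v => //; apply/rowP => i; rewrite !mxE tnth_map.
exists v => //; apply: eq_from_tnth => i; rewrite tnth_map.
by move/rowP : ft => /(_ i); rewrite !mxE.
Qed.

Lemma proj_volumeE n k (e : k.-tuple 'I_n) (A : {set 'I_n}) (T : set 'rV[R]_n) :
  enum A = e -> proj_volume A T = lebesgue_tuple (coord_tuple e @` T).
Proof.
move=> eA; have kE : #|A| = k by rewrite cardE eA size_tuple.
(* Replacing [k] by [#|A|] puts both sides in the same tuple type. *)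
case: k / kE e eA => e eA; rewrite /proj_volume; congr lebesgue_tuple.
rewrite image_comp; apply: eq_imagel => v _; apply: eq_from_tnth => i /=.
rewrite tnth_mktuple tnth_map.
have -> : tnth e i = enum_val i.
  by rewrite /enum_val eA (tnth_nth (enum_default i)).
rewrite summxE (bigD1 (enum_val i)) ?enum_valP//= big1 ?addr0 => [|j /andP[_ ji]].
  by rewrite !mxE !eqxx mulr1.
by rewrite !mxE eqxx eq_sym (negbTE ji) mulr0.
Qed.

End coordinate_projections.

(** * Loomis-Whitney for bodies in logarithmic coordinates, and rigidity *)

Section bodies.
Context {R : realType} {n : nat}.
Local Notation mR := (measurableTypeR R).
Local Notation vol := lebesgue_tuple.
Local Open Scope ereal_scope.

Lemma enum_sorted_seq (A : {set 'I_n}) (s : seq 'I_n) :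
  sorted (fun i j : 'I_n => (i < j)%N) s -> A =i s -> enum A = s.
Proof.
move=> s_sorted As; apply: (irr_sorted_eq (leT := fun i j : 'I_n => (i < j)%N)).
- by move=> j i k; exact: ltn_trans.
- by move=> i; exact: ltnn.
- rewrite {1}/enum_mem -enumT; apply: sorted_filter.
    by move=> j i k; exact: ltn_trans.
  by have := iota_ltn_sorted 0 n; rewrite -val_enum_ord sorted_map.
- exact: s_sorted.
- by move=> i; rewrite mem_enum As.
Qed.

(** The order of the indices makes the explicit tuples agree with [enum]. The slice length
    [s * p / v] turns into [expR (c + a - v)]. *)
Lemma loomis_whitney_body (T : set 'rV[R]_n) (i j k : 'I_n) (a b c v : R) :
  compact T -> (i < j)%N -> (j < k)%N ->
  proj_volume [set i; j] T = (expR a)%:E ->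
  proj_volume [set i; k] T = (expR b)%:E ->
  proj_volume [set j; k] T = (expR c)%:E ->
  proj_volume [set i; j; k] T = (expR v)%:E ->
  (2 * v <= a + b + c)%R /\
  ((2 * v = a + b + c)%R -> {ae (@lebesgue_measure R), forall x,
    vol (slice (coord_tuple [tuple i; j] @` T) x) = 0 \/
    vol (slice (coord_tuple [tuple i; j] @` T) x) = (expR (c + a - v))%:E}).
Proof.
move=> cT ij jk.
have ik := ltn_trans ij jk.
rewrite (@proj_volumeE _ _ _ [tuple i; j]); last first.
  by apply: enum_sorted_seq; [rewrite /= ij|move=> x; rewrite !inE].
rewrite (@proj_volumeE _ _ _ [tuple i; k]); last first.
  by apply: enum_sorted_seq; [rewrite /= ik|move=> x; rewrite !inE].
rewrite (@proj_volumeE _ _ _ [tuple j; k]); last first.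
  by apply: enum_sorted_seq; [rewrite /= jk|move=> x; rewrite !inE].
rewrite (@proj_volumeE _ _ _ [tuple i; j; k]); last first.
  by apply: enum_sorted_seq; [rewrite /= ij jk|move=> x; rewrite !inE orbA].
move=> volP volQ volS volV.
have VPQS x y (t : 1.-tuple mR) :
    (coord_tuple [tuple i; j; k] @` T) (tcons (x, tcons (y, t))) ->
    [/\ (coord_tuple [tuple i; j] @` T) (tcons (x, tcons (y, [tuple]))),
        (coord_tuple [tuple i; k] @` T) (tcons (x, t)) &
        (coord_tuple [tuple j; k] @` T) (tcons (y, t))].
  move=> [u Tu /(congr1 val)/= [ui uj uk]].
  split; exists u => //; apply: val_inj => /=; rewrite ?ui ?uj //.
  - by rewrite -uk.
  - by rewrite -uk.
have mT m (e : m.-tuple 'I_n) := measurable_coord_tuple e cT.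
have LW := loomis_whitney (mT _ _) (mT _ _) (mT _ _) (mT _ _) VPQS
  (expR_gt0 v) (expR_gt0 a) (expR_gt0 c) volV volP volQ volS.
have LWeq := loomis_whitney_eq (mT _ _) (mT _ _) (mT _ _) (mT _ _) VPQS
  (expR_gt0 v) (expR_gt0 a) (expR_gt0 c) volV volP volQ volS.
rewrite -!expRD -expRM_natl ler_expR in LW.
rewrite -!expRD -expRM_natl -expRN -expRD in LWeq.
by split => // eqv; apply: LWeq; rewrite eqv.
Qed.

(** Both equality cases constrain the slices of the shadow on [i, j]. If the two prescribed lengths
    differed, almost every slice would be null, and so would the shadow, whose area is
    [expR a > 0]. *)
Lemma loomis_whitney_body_rigid (T : set 'rV[R]_n) (i j k l : 'I_n)
    (a b c v b' c' v' : R) :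
  compact T -> (i < j)%N -> (j < k)%N -> (j < l)%N ->
  proj_volume [set i; j] T = (expR a)%:E ->
  proj_volume [set i; k] T = (expR b)%:E ->
  proj_volume [set j; k] T = (expR c)%:E ->
  proj_volume [set i; j; k] T = (expR v)%:E ->
  proj_volume [set i; l] T = (expR b')%:E ->
  proj_volume [set j; l] T = (expR c')%:E ->
  proj_volume [set i; j; l] T = (expR v')%:E ->
  (2 * v = a + b + c)%R -> (2 * v' = a + b' + c')%R -> (c - v = c' - v')%R.
Proof.
move=> cT ij jk jl va vb vc vv vb' vc' vv' eqv eqv'.
have [_ /(_ eqv) h] := loomis_whitney_body cT ij jk va vb vc vv.
have [_ /(_ eqv') h'] := loomis_whitney_body cT ij jl va vb' vc' vv'.
set P := coord_tuple _ @` T in h h'.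
have mP : measurable P by exact: measurable_coord_tuple.
apply/eqP/negPn/negP => ne.
have : vol P = 0.
  have P0 : {ae (@lebesgue_measure R), forall x, vol (slice P x) = 0}.
    apply: filterS2 h h' => x [->//|->] [|[/expR_inj eq]] //.
    by case/eqP: ne; lra.
  rewrite lebesgue_tupleS.
  rewrite (@ge0_ae_eq_integral _ _ _ _ _ _ (cst 0)) ?integral0//.
  - exact: measurable_fun_slice.
  - by move: P0; apply: filterS => x ->.
have -> : vol P = (expR a)%:E.
  rewrite -va (@proj_volumeE _ _ _ [tuple i; j])//.
  by apply: enum_sorted_seq; [rewrite /= ij|move=> x; rewrite !inE].
by move=> /eqP; rewrite eqe gt_eqF// expR_gt0.
Qed.

End bodies.

(** * Volumes of boxes and of unions of two boxes *)

Section boxes.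
Context {R : realType} {n : nat}.
Implicit Types (b : 'I_n -> R) (A : {set 'I_n}).
Local Notation mR := (measurableTypeR R).
Local Notation vol := lebesgue_tuple.

Definition exp_box b : set 'rV[R]_n :=
  [set v | forall i, v ord0 i \in `[0, expR (b i)]].

Lemma compact_exp_box b : compact (exp_box b).
Proof.
apply: (@rV_compact R n (fun i => [set` `[0, expR (b i)]])) => i.
exact: segment_compact.
Qed.

Lemma coord_tuple_exp_box b k (e : k.-tuple 'I_n) : uniq e ->
  coord_tuple e @` exp_box b =
  [set t : k.-tuple mR | forall i, [set` `[0, expR (b (tnth e i))]] (tnth t i)].
Proof.
move=> uniq_e; apply/seteqP; split => [_ [v bv <-] i|t bt] /=.
  by rewrite tnth_map; exact: bv.
(* A coordinate outside [e] has index [size e] and receives the default [0], which lies in every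
   side of the box. *)
exists (\row_i nth (0 : R) t (index i e)); last first.
  apply: eq_from_tnth => i; rewrite tnth_map mxE (tnth_nth 0).
  by rewrite (tnth_nth (tnth e i)) index_uniq// size_tuple.
move=> i; rewrite mxE; have [ie|ie] := boolP (i \in e); last first.
  rewrite nth_default ?in_itv/= ?lexx ?expR_ge0//.
  by rewrite size_tuple -[X in (X <= _)%N](size_tuple e) leqNgt index_mem.
have lt_ie : (index i e < k)%N by rewrite -[X in (_ < X)%N](size_tuple e) index_mem.
have := bt (Ordinal lt_ie).
by rewrite /= (tnth_nth 0) (tnth_nth i)/= nth_index.
Qed.

Lemma vol_exp_box b A : proj_volume A (exp_box b) = (expR (\sum_(i in A) b i))%:E.
Proof.
pose e := in_tuple (enum A).
rewrite (@proj_volumeE _ _ _ e)// coord_tuple_exp_box ?enum_uniq//.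
rewrite (@lebesgue_tuple_box R _ (fun i => [set` `[0, expR (b (tnth e i))]]))//.
rewrite expR_sum.
have leb (x : R) : lebesgue_measure [set` `[0, expR x]] = (expR x)%:E.
  by rewrite lebesgue_measure_itv/= lte_fin expR_gt0 oppr0 adde0.
rewrite (eq_bigr (fun i => (expR (b (tnth e i)))%:E)) => [|i _]; last exact: leb.
rewrite prodEFin; congr (_%:E); rewrite -[RHS]big_enum.
exact/esym/(big_tuple _ _ e xpredT (fun i => expR (b i))).
Qed.

Lemma constructible_sums b :
  constructible_region R n (\row_(j < #|nonempty_subsets n|) \sum_(i in enum_val j) b i).
Proof.
exists (exp_box b); split; first exact: compact_exp_box.
by move=> j; rewrite mxE vol_exp_box lne_EFin ?expR_gt0// expRK.
Qed.

(** For the union of two boxes, each shadow contains both box shadows and has at most their total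
    volume, hence at most twice the larger one; this factor is the [ln 2]. *)
Lemma constructible_max_sums b1 b2 : exists2 y, constructible_region R n y &
  forall j : 'I_#|nonempty_subsets n|,
    let x := Num.max (\sum_(i in enum_val j) b1 i) (\sum_(i in enum_val j) b2 i) in
    x <= y ord0 j <= x + ln 2.
Proof.
pose T := exp_box b1 `|` exp_box b2.
have volT A (x := Num.max (\sum_(i in A) b1 i) (\sum_(i in A) b2 i)) :
    exists2 y : R, x <= y <= x + ln 2 & proj_volume A T = (expR y)%:E.
  pose e := in_tuple (enum A).
  have pE (U : set 'rV[R]_n) : proj_volume A U = vol (coord_tuple e @` U) by exact: proj_volumeE.
  have mb b : measurable (coord_tuple e @` exp_box b).
    by apply: measurable_coord_tuple; exact: compact_exp_box.
  have mT : measurable (coord_tuple e @` T) by rewrite image_setU; exact: measurableU.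
  have sub b : exp_box b `<=` T ->
      ((expR (\sum_(i in A) b i))%:E <= proj_volume A T)%E.
    move=> bT; rewrite -vol_exp_box !pE; apply: le_measure; rewrite ?inE//.
    exact: image_subset.
  have le1 : ((expR x)%:E <= proj_volume A T)%E.
    rewrite /x; case: (leP (\sum_(i in A) b1 i)) => _; first exact: (sub b2 (@subsetUr _ _ _)).
    exact: (sub b1 (@subsetUl _ _ _)).
  have le2 : (proj_volume A T <= (expR (x + ln 2))%:E)%E.
    have leU : (proj_volume A T <=
        proj_volume A (exp_box b1) + proj_volume A (exp_box b2))%E.
      by rewrite !pE image_setU; exact: measureU2.
    apply: (le_trans leU); rewrite !vol_exp_box -EFinD lee_fin expRD lnK ?posrE//.
    by rewrite mulr_natr mulr2n lerD// ler_expR /x le_max lexx ?orbT.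
  case: (proj_volume A T) le1 le2 => [r| |]//; rewrite !lee_fin => le1 le2.
  have r0 : 0 < r by apply: lt_le_trans le1; exact: expR_gt0.
  exists (ln r); last by rewrite lnK.
  by apply/andP; split; rewrite -ler_expR lnK ?posrE.
have [y yP yvol] : exists2 y : 'rV[R]_#|nonempty_subsets n|,
    (forall j : 'I_#|nonempty_subsets n|,
    let x := Num.max (\sum_(i in enum_val j) b1 i) (\sum_(i in enum_val j) b2 i) in
      x <= y ord0 j <= x + ln 2) &
    forall j, proj_volume (enum_val j) T = (expR (y ord0 j))%:E.
  exists (\row_j sval (cid2 (volT (enum_val j)))) => j; rewrite mxE.
    by case: cid2.
  by case: cid2.
exists y => //; exists T; split; first by apply: compactU; exact: compact_exp_box.
by move=> j; rewrite yvol lne_EFin ?expR_gt0// expRK.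
Qed.

End boxes.

(** * Rescaled bodies and limit points of the hull *)

Lemma convex_hull_scale (R : realType) (M : lmodType R) (S : set M) (t : R) (y : M) :
  S 0 -> S y -> 0 <= t <= 1 -> convex_hull S (t *: y).
Proof.
move=> S0 Sy /andP[t0 t1] G [cG SG].
have /set_mem := cG y 0 (Itv01 t0 t1) (mem_set (SG _ Sy)) (mem_set (SG _ S0)).
by rewrite /conv/= scaler0 addr0.
Qed.

(* Dilating the sides of the two boxes by a large power [N] and rescaling the
   logarithms makes the error [ln 2] of the union bound negligible. *)
Lemma closed_hull_max_sums (R : realType) n (b1 b2 : 'I_n -> R) :
  closed (convex_hull (constructible_region R n)) ->
  convex_hull (constructible_region R n)
    (\row_(j < #|nonempty_subsets n|)
      Num.max (\sum_(i in enum_val j) b1 i) (\sum_(i in enum_val j) b2 i)).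
Proof.
move=> clH; set x := \row_j _; apply: contrapT => nHx.
have /nbhs_ballP[r /= r0 Br] := open_nbhs_nbhs (conj (closed_openC clH) nHx).
have ln2_gt0 : 0 < ln 2 :> R by rewrite ln_gt0 ?ltr1n.
have rln2 : 0 < r / ln 2 by rewrite divr_gt0.
have [N _ /(_ N (leqnn _))/= Nr] := near_infty_natSinv_lt (PosNum rln2).
have N0 : 0 < N.+1%:R :> R by [].
have [y psi_y y_bound] := constructible_max_sums
  (fun i => N.+1%:R * b1 i) (fun i => N.+1%:R * b2 i).
apply: (Br (N.+1%:R^-1 *: y)); last first.
  apply: convex_hull_scale => //; last by rewrite invr_ge0 ler0n invf_le1// ler1n.
  (* The zero vector comes from the unit cube, whose sides are [expR 0]. *)
  rewrite (_ : 0 = \row_(j < #|nonempty_subsets n|) \sum_(i in enum_val j) 0).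
    exact: constructible_sums.
  by apply/rowP => j; rewrite !mxE big1.
split => // i j; rewrite ord1 !mxE.
move: (y_bound j); rewrite /= -!mulr_sumr -maxr_pMr ?ler0n//.
set X := Num.max _ _ => /andP[Xy yX].
have le1 : X <= N.+1%:R^-1 * y ord0 j by rewrite ler_pdivlMl.
have le2 : N.+1%:R^-1 * y ord0 j <= X + N.+1%:R^-1 * ln 2.
  by rewrite ler_pdivrMl// mulrDr mulVKf ?gt_eqF.
have lt3 : N.+1%:R^-1 * ln 2 < r by rewrite -ltr_pdivlMr.
have dist_lt (a b c : R) : a <= b -> b <= a + c -> c < r -> `|a - b| < r.
  by move=> ab bac cr; rewrite ltr_norml; lra.
exact: dist_lt le1 le2 lt3.
Qed.

(** * A convex set that contains the region but misses the limit point *)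

Lemma lne_EFin_eq (R : realType) (r : R) (v : \bar R) :
  r%:E = lne v -> v = (expR r)%:E.
Proof.
case: v => [v| |]//=; case: ifPn => //; rewrite -ltNge => v0 [->].
by rewrite lnK.
Qed.

Theorem theorem9 (R : realType) (n : nat) (hn : (4 <= n)%N) :
  ~ closed (convex_hull (constructible_region R n)).
Proof.
have idx (i : 'I_n) (A : {set 'I_n}) : i \in A ->
    exists j : 'I_#|nonempty_subsets n|, enum_val j = A.
  move=> iA; have A0 : A \in nonempty_subsets n.
    by rewrite inE; apply/finset.set0Pn; exists i.
  by exists (enum_rank_in A0 A); rewrite enum_rankK_in.
pose i0 : 'I_n := Ordinal (leq_trans (isT : (0 < 4)%N) hn).
pose i1 : 'I_n := Ordinal (leq_trans (isT : (1 < 4)%N) hn).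
pose i2 : 'I_n := Ordinal (leq_trans (isT : (2 < 4)%N) hn).
pose i3 : 'I_n := Ordinal (leq_trans (isT : (3 < 4)%N) hn).
have [j01 e01] := idx i0 [set i0; i1]%SET (set21 _ _).
have [j02 e02] := idx i0 [set i0; i2]%SET (set21 _ _).
have [j12 e12] := idx i1 [set i1; i2]%SET (set21 _ _).
have [j03 e03] := idx i0 [set i0; i3]%SET (set21 _ _).
have [j13 e13] := idx i1 [set i1; i3]%SET (set21 _ _).
have [j012 e012] := idx i0 [set i0; i1; i2]%SET
  (introT finset.setUP (or_introl (set21 i0 i1))).
have [j013 e013] := idx i0 [set i0; i1; i3]%SET
  (introT finset.setUP (or_introl (set21 i0 i1))).
(* [f] and [g] are the logarithmic Loomis-Whitney deficits on the first three coordinates and on the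
   first, second and fourth; [h] is the quantity that rigidity makes vanish when both deficits
   do. *)
pose f (y : 'rV[R]_#|nonempty_subsets n|) :=
  y ord0 j01 + y ord0 j02 + y ord0 j12 - 2 * y ord0 j012.
pose g (y : 'rV[R]_#|nonempty_subsets n|) :=
  y ord0 j01 + y ord0 j03 + y ord0 j13 - 2 * y ord0 j013.
pose h (y : 'rV[R]_#|nonempty_subsets n|) :=
  (y ord0 j12 - y ord0 j012) - (y ord0 j13 - y ord0 j013).
pose G := [set y | [/\ 0 <= f y, 0 <= g y & f y = 0 -> g y = 0 -> h y = 0]].
have convG : convex_set G.
  move=> x y t /set_mem[fx gx hx] /set_mem[fy gy hy]; apply/mem_set.
  pose z : 'rV[R]_#|nonempty_subsets n| := t%:num *: x + (1 - t%:num) *: y.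
  change (G z).
  have t0 : 0 <= t%:num by [].
  have t1 : 0 <= 1 - t%:num by rewrite subr_ge0.
  have zE j : z ord0 j = t%:num * x ord0 j + (1 - t%:num) * y ord0 j.
    by rewrite !mxE.
  have fz : f z = t%:num * f x + (1 - t%:num) * f y by rewrite /f !zE; ring.
  have gz : g z = t%:num * g x + (1 - t%:num) * g y by rewrite /g !zE; ring.
  have hz : h z = t%:num * h x + (1 - t%:num) * h y by rewrite /h !zE; ring.
  (* A point of positive weight in a combination with zero deficits has zero deficits itself; a
     point of weight [0] contributes nothing. *)
  have face (s : R) u : (f u = 0 -> g u = 0 -> h u = 0) ->
      s * f u = 0 -> s * g u = 0 -> s * h u = 0.
    move=> hu /eqP; rewrite mulf_eq0 => /predU1P[->|/eqP fu]; first by rewrite !mul0r.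
    move=> /eqP; rewrite mulf_eq0 => /predU1P[->|/eqP gu]; first by rewrite !mul0r.
    by rewrite hu// mulr0.
  have sum0 (a b : R) : 0 <= a -> 0 <= b -> a + b = 0 -> a = 0 /\ b = 0.
    by move=> a0 b0 ab; split; lra.
  split; rewrite ?fz ?gz ?hz ?addr_ge0 ?mulr_ge0//.
  move=> /sum0[]; rewrite ?mulr_ge0// => tfx tfy.
  move=> /sum0[]; rewrite ?mulr_ge0// => tgx tgy.
  by rewrite (face _ x)// (face _ y)// addr0.
have psiG : constructible_region R n `<=` G.
  move=> y [T [cT Tvol]].
  have vol A j : enum_val j = A -> proj_volume A T = (expR (y ord0 j))%:E.
    by move=> <-; apply: lne_EFin_eq; exact: Tvol.
  have v01 := vol _ _ e01.
  have v02 := vol _ _ e02.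
  have v12 := vol _ _ e12.
  have v012 := vol _ _ e012.
  have v03 := vol _ _ e03.
  have v13 := vol _ _ e13.
  have v013 := vol _ _ e013.
  have [fy _] := @loomis_whitney_body _ _ T i0 i1 i2 _ _ _ _ cT isT isT v01 v02 v12 v012.
  have [gy _] := @loomis_whitney_body _ _ T i0 i1 i3 _ _ _ _ cT isT isT v01 v03 v13 v013.
  split; rewrite /f /g /h ?subr_ge0// => /eqP; rewrite subr_eq0 => /eqP fy0.
  move=> /eqP; rewrite subr_eq0 => /eqP gy0; apply/eqP; rewrite subr_eq0; apply/eqP.
  exact: (@loomis_whitney_body_rigid _ _ T i0 i1 i2 i3 _ _ _ _ _ _ _ cT isT isT isT
    v01 v02 v12 v012 v03 v13 v013 (esym fy0) (esym gy0)).
(* The default value of [nth] sets all coordinates beyond the fourth to [0]. *)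
move=> clH; pose b1 (i : 'I_n) : R := nth 0 [:: 1; -1; 0; -2] i.
pose b2 (i : 'I_n) : R := nth 0 [:: -1; 1; -2; 0] i.
(* The hull is the intersection of all convex sets containing the region, so its points lie in
   [G]. *)
have := closed_hull_max_sums b1 b2 clH (conj convG psiG).
rewrite /G /f /g /h /= !mxE e01 e02 e12 e012 e03 e13 e013.
have sum2 (i j : 'I_n) b : i != j -> \sum_(l in [set i; j]%SET) b l = b i + b j :> R.
  by move=> ij; rewrite big_setU1 ?inE//= big_set1.
have sum3 (i : 'I_n) b : (1 < i)%N ->
    \sum_(l in [set i0; i1; i]%SET) b l = b i0 + b i1 + b i :> R.
  move=> i_gt1; rewrite finset.setUC big_setU1/= ?sum2 1?addrC//.
  by rewrite !inE negb_or -!val_eqE/= !gtn_eqF// ltnW.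
rewrite !sum2// !sum3// /b1 /b2 /=.
have maxl (a b c : R) : b <= a -> a = c -> Num.max a b = c.
  by move=> ba <-; rewrite max_l.
have maxr (a b c : R) : a <= b -> b = c -> Num.max a b = c.
  by move=> ab <-; rewrite max_r.
rewrite (maxl (1 - 1) _ 0) ?(maxl (1 + 0) _ 1) ?(maxl (-1 + 0) _ (-1));
  rewrite ?(maxl (1 - 1 + 0) _ 0) ?(maxr (1 - 2) _ (-1)) ?(maxr (-1 - 2) _ 1);
  rewrite ?(maxr (1 - 1 - 2) _ 0); clear; try lra.
(* The seven maxima give [f = 0 + 1 - 1 - 0 = 0] and [g = 0 - 1 + 1 - 0 = 0], but
   [h = -1 - 1 = -2]. *)
by move=> [_ _ h0]; have := h0 ltac:(lra) ltac:(lra); lra.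
Qed.
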